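(* Let $0<\beta\le 1/2$, $0<p<1$, $q=1-p$, with $(\beta,p)\neq(1/2,1/2)$. With the sequences $a_n=1/\beta^n$, $b_n=1$, and $k_n=\lfloor 1/q^n\rfloor$, we have for all $x<0$ that $$\lim_{n\to\infty}F_{\beta,p}(x/a_n+b_n)^{k_n}=\exp\big\{-(-x)^{\log q/\log\beta}\,\nu_{\beta,q}(\log(-x))\big\}.$$
   Context: For $0<\beta\le1/2$, $0<p<1$, $q=1-p$, $F_{\beta,p}$ denotes the unique distribution function on $\mathbb{R}$ satisfying $F(x)=pF(x/\beta)+qF(x/\beta+1-1/\beta)$ for all $x\in\mathbb{R}$; it vanishes on $(-\infty,0]$, equals $1$ on $[1,\infty)$, and satisfies $F_{\beta,p}(x)=x^{\log p/\log\beta}\,\nu_{\beta,p}(\log x)$ for $0<x\le1$, where $\nu_{\beta,p}:\mathbb{R}\to\mathbb{R}$ is the function of period $|\log\beta|$ determined by $\nu_{\beta,p}(t)=e^{-t\log p/\log\beta}F_{\beta,p}(e^t)$ for $t\le0$. The functions $F_{\beta,q}$ and $\nu_{\beta,q}$ are the ones obtained by interchanging the roles of $p$ and $q$. *)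

(* Defs.v *)
From HB Require Import structures.
From mathcomp Require Import all_boot all_order all_algebra.
From mathcomp Require Import all_classical all_reals all_analysis.

Set Implicit Arguments.
Unset Strict Implicit.
Unset Printing Implicit Defensive.

Import Order.TTheory GRing.Theory Num.Theory.
Import numFieldNormedType.Exports.

Local Open Scope classical_set_scope.
Local Open Scope ring_scope.

(* [cumulativeBounded 0 1] is the library's structure of nondecreasing,
   right-continuous functions with limits 0 at -oo and 1 at +oo. *)
Definition is_distribution_function (R : realType) (F : R -> R) : Prop :=
  exists G : cumulativeBounded (0 : R) (1 : R), F = G :> (R -> R).

Definition selfsimilar_eq (R : realType) (beta p : R) (F : R -> R) : Prop :=
  forall x : R,
    F x = p * F (x / beta) + (1 - p) * F (x / beta + 1 - beta^-1).

(* Definite description: for 0 < beta <= 1/2 and 0 < p < 1 exactly one function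
   belongs to the set below, and [get] selects it. For other parameters the
   value is irrelevant. *)
Definition Fdist (R : realType) (beta p : R) : R -> R :=
  get [set F : R -> R | is_distribution_function F /\ selfsimilar_eq beta p F].

(* Again a definite description: the values on t <= 0 and the period determine
   the function. *)
Definition nu (R : realType) (beta p : R) : R -> R :=
  get [set f : R -> R | periodic f `|ln beta| /\
    forall t : R, t <= 0 ->
      f t = expR (- t * (ln p / ln beta)) * Fdist beta p (expR t)].

(* Main.v *)
(** The self-similarity equation determines its solution: outside [0, 1] the
    values are forced, and for beta <= 1/2 at most one of the two terms on the
    right-hand side differs between two solutions, so their difference
    contracts by the factor max(p, q).  Since 1 - F_{beta,p}(1 - x) solves the
    equation with p and q exchanged, it equals F_{beta,q}(x).  Near 0 only one
    term survives, giving F_{beta,q}(beta^n y) = q^n L with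
    L = y^(log q / log beta) nu_{beta,q}(log y) as soon as beta^n y <= 1.
    Hence the quantity of interest is (1 - q^n L)^floor(1/q^n), which tends to
    exp(-L).  A solution F_{beta,p} exists as the decreasing limit of the
    iterates of the self-similarity operator started at the indicator of
    [0, +oo[. *)

Require Import Defs.
From HB Require Import structures.
From mathcomp Require Import all_boot all_order all_algebra.
From mathcomp Require Import all_classical all_reals all_analysis.
From mathcomp Require Import ring lra.
Import Order.TTheory GRing.Theory Num.Theory.
Import numFieldNormedType.Exports.
Local Open Scope classical_set_scope.
Local Open Scope ring_scope.

(** * Self-similar functions: reflection, support, uniqueness and scaling *)

Lemma selfsimilar_reflect (R : realType) (beta p : R) (F : R -> R) :
  selfsimilar_eq beta p F ->
  selfsimilar_eq beta (1 - p) (fun x => 1 - F (1 - x)).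
Proof.
move=> FE x; rewrite FE.
(* The map x to 1 - x exchanges the two arguments of the equation; the constant 1 is preserved
   because the weights sum to 1. *)
have -> : (1 - x) / beta = 1 - (x / beta + 1 - beta^-1) by rewrite mulrBl; lra.
have -> : 1 - (x / beta + 1 - beta^-1) + 1 - beta^-1 = 1 - x / beta by ring.
by ring.
Qed.

Lemma exprn_mul_small (R : realType) (c M e : R) :
  0 <= c < 1 -> 0 < e -> exists n, c ^+ n * M < e.
Proof.
move=> /andP[c0 c1] e0.
have /cvgMr_tmp : (fun n => c ^+ n) @ \oo --> (0 : R).
  by apply: cvg_expr; rewrite ger0_norm.
move=> /(_ M); rewrite mul0r => /(cvgr_lt _) /(_ _ e0) [n _ H].
by exists n; apply: H => /=.
Qed.

(** The form in which [beta <= 1 / 2] is used: the shift [1 - beta^-1] is at most -1, so it sends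
    arguments at most 1 to nonpositive ones. *)
Lemma ge2_invr (R : realType) (x : R) : 0 < x <= 1 / 2 -> 2 <= x^-1.
Proof.
by case/andP=> ? ?; rewrite -[2]invrK lef_pV2 ?posrE ?invr_gt0// -div1r.
Qed.

Section selfsimilar_cdf.
Context {R : realType} (beta p : R).
Hypotheses (hbeta : 0 < beta <= 1 / 2) (hp : 0 < p < 1).

Let beta_gt0 : 0 < beta. Proof. by case/andP: hbeta. Qed.
(** Both arguments are at most x / beta, so monotonicity gives F x <= F (x / beta^n), and for x < 0
    the right side tends to the limit 0 at -oo. At 0 the equation then reads F 0 = p F 0 with p <
    1. *)
Lemma selfsimilar_eq0 (F : R -> R) :
  {homo F : x y / x <= y} -> F @ -oo --> 0 -> selfsimilar_eq beta p F ->
  forall x, x <= 0 -> F x = 0.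
Proof.
have bV := ge2_invr _ _ hbeta; case/andP: (hp) => p0 p1 ndF F0 FE.
have F_ge0 x : 0 <= F x.
  rewrite leNgt; apply/negP => Fx0.
  have [M [_ HM]] := cvgr_gt _ F0 _ Fx0.
  have := HM (Num.min x (M - 1)); rewrite /= gt_min ltrBlDr ltrDl ltr01 orbT.
  move=> /(_ isT); apply/negP; rewrite -leNgt; apply: ndF.
  by rewrite ge_min lexx.
have F_lt0 x : x < 0 -> F x = 0.
  move=> x0; apply/eqP; rewrite eq_le F_ge0 andbT; apply/ler_addgt0Pr => e e0.
  rewrite add0r; have [M [_ HM]] := cvgr_lt _ F0 _ e0.
  (* The bound beta^n (-M) < -x says that x / beta^n < M. *)
  have [||n] := @exprn_mul_small _ beta (- M) (- x); [|by rewrite oppr_gt0|].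
    by case/andP: hbeta => ? ?; lra.
  rewrite mulrN ltrN2 => nM; apply/ltW.
  apply: (@le_lt_trans _ _ (F (x / beta ^+ n))).
    elim: n {nM} => [|n IH]; first by rewrite expr0 divr1.
    apply: le_trans IH _; rewrite exprSr invfM mulrA.
    set y := x / beta ^+ n; rewrite FE.
    have : F (y / beta + 1 - beta^-1) <= F (y / beta) by apply: ndF; lra.
    by set u := F _; set v := F _; nra.
  by apply: HM => /=; rewrite ltr_pdivrMr ?exprn_gt0// mulrC.
move=> x; rewrite le_eqVlt => /predU1P[->|]; last exact: F_lt0.
have := FE 0; rewrite mul0r add0r (F_lt0 (1 - _)); last by lra.
rewrite mulr0 addr0 => /eqP; rewrite -subr_eq0.
rewrite -[X in X - _]mul1r -mulrBl mulf_eq0.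
by case/orP => /eqP //; lra.
Qed.

(* Right-continuity is left out: uniqueness does not need it, and without it
   the class is stable under the reflection [F |-> (x |-> 1 - F (1 - x))]. *)
Definition unit_solution (F : R -> R) :=
  [/\ forall x, x <= 0 -> F x = 0, forall x, 1 <= x -> F x = 1,
      forall x, 0 <= F x <= 1 & selfsimilar_eq beta p F].

Lemma unit_solution_unique (F G : R -> R) :
  unit_solution F -> unit_solution G -> F = G.
Proof.
have bV := ge2_invr _ _ hbeta; case/andP: (hp) => p0 p1.
move=> [F0 F1 Fb FE] [G0 G1 Gb GE]; apply/funext => x.
pose c := Num.max p (1 - p).
have c0 : 0 <= c by rewrite le_max ltW.
have D n y : `|F y - G y| <= c ^+ n.
  elim: n y => [|n IH] y.
    by rewrite expr0 ler_norml; case/andP: (Fb y); case/andP: (Gb y); lra.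
  (* If y / beta < 1, the second argument is at most 0, where both functions vanish; otherwise the
     first is at least 1, where both equal 1. *)
  rewrite FE GE exprS; have [y1|y1] := ltP (y / beta) 1.
    rewrite (F0 (_ + 1 - _)) ?(G0 (_ + 1 - _)); [|lra|lra].
    rewrite !mulr0 !addr0 -mulrBr normrM.
    apply: ler_pM => //; by rewrite ger0_norm ?le_max ?lexx// ltW.
  rewrite (F1 (y / beta))// (G1 (y / beta))// opprD addrACA subrr add0r.
  rewrite -mulrBr normrM.
  apply: ler_pM => //.
  by rewrite ger0_norm ?subr_ge0 ?le_max ?lexx ?orbT// ltW.
apply/eqP; rewrite -subr_eq0 -normr_le0; apply/ler_addgt0Pr => e e0.
have [|n cn] := @exprn_mul_small _ c 1 e _ e0.
  by rewrite c0 gt_max p1; lra.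
by rewrite add0r (le_trans (D n x))// -[_ ^+ _]mulr1 ltW.
Qed.

(** As beta^n x <= 1, its shift by [1 - beta^-1] is nonpositive, so each use of the equation leaves
    only the term with factor p. *)
Lemma unit_solution_scale (F : R -> R) (n : nat) (x : R) :
  unit_solution F -> x <= 1 -> F (beta ^+ n * x) = p ^+ n * F x.
Proof.
have bV := ge2_invr _ _ hbeta; case/andP: hbeta => _ b1.
move=> [F0 F1 Fb FE] x1; elim: n => [|n IH]; first by rewrite !mul1r.
have E : beta ^+ n.+1 * x / beta = beta ^+ n * x.
  by rewrite exprS; field; rewrite gt_eqF.
rewrite FE E IH (F0 (_ + 1 - _)).
  by rewrite mulr0 addr0 exprS mulrA.
have : beta ^+ n * x <= 1.
  have [x0|x0] := leP x 0.
    by rewrite (le_trans _ ler01)// mulr_ge0_le0// exprn_ge0// ltW.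
  by rewrite mulr_ile1 ?exprn_ge0 ?exprn_ile1 ?(ltW x0) ?(ltW beta_gt0)//; lra.
by lra.
Qed.

End selfsimilar_cdf.

Lemma unit_solution_reflect (R : realType) (beta p : R) (F : R -> R) :
  unit_solution beta p F -> unit_solution beta (1 - p) (fun x => 1 - F (1 - x)).
Proof.
move=> [F0 F1 Fb FE]; split.
- by move=> x x0; rewrite F1 ?subrr//; lra.
- by move=> x x0; rewrite F0 ?subr0//; lra.
- by move=> x; case/andP: (Fb (1 - x)); lra.
- exact: selfsimilar_reflect.
Qed.

(** [selfsimilar_eq0] gives the values left of 0, and applied to the reflection, which tends to 0 at
    -oo, those right of 1. *)
Lemma distribution_unit_solution (R : realType) (beta p : R) (F : R -> R) :
  0 < beta <= 1 / 2 -> 0 < p < 1 ->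
  is_distribution_function F -> selfsimilar_eq beta p F ->
  unit_solution beta p F.
Proof.
move=> hb hp [G ->] GE.
have ndG : {homo G : x y / x <= y} := @cumulative_is_nondecreasing _ _ _ G.
have G0 : forall x, x <= 0 -> G x = 0.
  exact: (selfsimilar_eq0 _ _ hb hp _ ndG (cumulativeNy G) GE).
have G1 : forall x, 1 <= x -> G x = 1.
  have hp' : 0 < 1 - p < 1 by lra.
  have nd : {homo (fun x => 1 - G (1 - x)) : x y / x <= y}.
    by move=> x y xy; rewrite lerD2l lerN2 ndG// lerD2l lerN2.
  have lim : (fun x => 1 - G (1 - x)) @ -oo --> (0 : R).
    rewrite -[X in _ --> X](subrr 1); apply: cvgB; first exact: cvg_cst.
    apply: (cvg_comp _ _ _ (cumulativey G)).
    move=> A [M [Mr MA]]; exists (1 - M); split; first exact: num_real.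
    by move=> y /= yM; apply: MA; lra.
  move=> x x1.
  have := selfsimilar_eq0 _ _ hb hp' _ nd lim (selfsimilar_reflect _ _ _ _ GE).
  by move=> /(_ (1 - x)); rewrite subKr => H; have := H ltac:(lra); lra.
split=> // x; apply/andP; split.
  have [x0|/ltW x0] := leP x 0; first by rewrite G0.
  by have := ndG _ _ x0; rewrite (G0 0).
have [x1|/ltW x1] := leP 1 x; first by rewrite G1.
by have := ndG _ _ x1; rewrite (G1 1).
Qed.

(** * The exponential limit *)

Lemma power_exp_cvg (R : realType) (q L : R) : 0 < q < 1 -> 0 <= L ->
  (fun n => (1 - q ^+ n * L) ^+ Num.truncn (1 / q ^+ n)) @ \oo --> expR (- L).
Proof.
move=> /andP[q0 q1] L0.
pose k n := Num.truncn (1 / q ^+ n).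
have qn0 n : 0 < q ^+ n by rewrite exprn_gt0.
have cq : (fun n => q ^+ n) @ \oo --> (0 : R).
  by apply: cvg_expr; rewrite ger0_norm ?ltW.
have cqL : (fun n => q ^+ n * L) @ \oo --> (0 : R).
  by rewrite -(mul0r L); apply: cvgMr_tmp.
have ck : (fun n => (k n)%:R * (q ^+ n * L)) @ \oo --> L.
  suff : (fun n => (k n)%:R * q ^+ n * L) @ \oo --> 1 * L.
    by rewrite mul1r; under eq_fun do rewrite -mulrA.
  apply: cvgMr_tmp.
  (* The integer part k satisfies 1 - q^n < k q^n <= 1. *)
  apply: (@squeeze_cvgr _ _ _ _ (fun n => 1 - q ^+ n) (cst 1)).
  - apply: nearW => n /=.
    have /andP[] := truncn_itv (ltW (divr_gt0 ltr01 (qn0 n))).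
    rewrite -/(k n) ler_pdivlMr// ltr_pdivrMr// -natr1 mulrDl mul1r => -> ?.
    by lra.
  - by rewrite -[X in _ --> X]subr0; apply: cvgB => //; exact: cvg_cst.
  - exact: cvg_cst.
have cl : (fun n => - ((k n)%:R * (q ^+ n * L)) / (1 - q ^+ n * L))
    @ \oo --> - L.
  rewrite -[X in _ --> X]divr1; apply: cvgM; first exact: cvgN.
  apply: cvgV; first exact: oner_neq0.
  by rewrite -[X in _ --> X]subr0; apply: cvgB => //; exact: cvg_cst.
(* Let u = q^n L, eventually below 1. The inequality 1 + t <= exp t at t = -u and at t = u / (1 -
   u), where 1 + t = 1 / (1 - u), gives exp(-k u / (1 - u)) <= (1 - u)^k <= exp(-k u). *)
apply: (@squeeze_cvgr _ _ _ _
  (fun n => expR (- ((k n)%:R * (q ^+ n * L)) / (1 - q ^+ n * L)))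
  (fun n => expR (- ((k n)%:R * (q ^+ n * L))))).
- near=> n.
  have u1 : q ^+ n * L < 1 by near: n; apply: (cvgr_lt _ cqL).
  have u0 : 0 < 1 - q ^+ n * L by rewrite subr_gt0.
  rewrite -/(k n); set u := q ^+ n * L in u1 u0 *.
  rewrite [X in expR X <= _](_ : _ = (k n)%:R * - (u / (1 - u))); last first.
    by rewrite mulNr -mulrA mulrN.
  rewrite -(mulrN (k n)%:R) !expRM_natl.
  have le_u : 1 - u <= expR (- u) by exact: expR_ge1Dx.
  have ge_u : expR (- (u / (1 - u))) <= 1 - u.
    rewrite expRN -[leRHS]invrK lef_pV2 ?posrE ?expR_gt0 ?invr_gt0//.
    apply: le_trans (expR_ge1Dx _); rewrite le_eqVlt; apply/orP; left.
    by apply/eqP; field; rewrite gt_eqF.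
  by apply/andP; split; rewrite lerXn2r ?nnegrE ?expR_ge0// ltW.
- exact: (continuous_cvg _ (@continuous_expR R (- L))).
- exact: (continuous_cvg _ (@continuous_expR R (- L)) (cvgN ck)).
Unshelve. all: by end_near. Qed.

(** * Existence of a self-similar distribution function *)

Section existence.
Context {R : realType} (beta p : R).
Hypotheses (hbeta : 0 < beta <= 1 / 2) (hp : 0 < p < 1).

Let beta_gt0 : 0 < beta. Proof. by case/andP: hbeta. Qed.

Let operator (F : R -> R) (x : R) :=
  p * F (x / beta) + (1 - p) * F (x / beta + 1 - beta^-1).

Let approx n := iter n operator (fun x => (0 <= x)%R%:R).

Let approx_nd n : {homo approx n : x y / x <= y}.
Proof.
case/andP: (hp) => p0 p1; elim: n => [|n IH] x y xy /=.
  rewrite ler_nat; have [x0|//] := boolP (0 <= x).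
  by rewrite (le_trans x0 xy).
have xyb : x / beta <= y / beta by rewrite ler_pM2r ?invr_gt0.
by apply: lerD; rewrite ler_pM2l ?subr_gt0// IH// lerB// lerD2r.
Qed.

(** The operator is monotone, so it suffices that it lowers the initial indicator. *)
Let approx_dec x : nonincreasing_seq (approx ^~ x).
Proof.
have bV := ge2_invr _ _ hbeta; case/andP: (hp) => p0 p1.
apply/nonincreasing_seqP => n; elim: n x => [|n IH] x /=.
  have le (z : R) : 0 <= ((0 <= z)%R%:R : R) <= 1.
    by rewrite ler0n lern1; case: (0 <= z).
  rewrite /operator; have [x0|x0] := ltP x 0.
    have y0 : x / beta < 0 by rewrite ltr_pdivrMr ?mul0r.
    have z0 : x / beta + 1 - beta^-1 < 0 by lra.
    by rewrite (leNgt 0 (x / beta)) y0 (leNgt 0 (_ + 1 - _)) z0 !mulr0 addr0.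
  have /andP[_ u1] := le (x / beta).
  have /andP[_ v1] := le (x / beta + 1 - beta^-1).
  apply: (@le_trans _ _ (p * 1 + (1 - p) * 1)); last by rewrite !mulr1 subrKC.
  by apply: lerD; rewrite ler_pM2l ?subr_gt0.
by apply: lerD; rewrite ler_pM2l ?subr_gt0//; exact: IH.
Qed.

(** Both argument maps preserve the negative half-line. The point 0 is excluded since [approx n 0]
    is p^n. *)
Let approx_lt0 n x : x < 0 -> approx n x = 0.
Proof.
have bV := ge2_invr _ _ hbeta.
elim: n x => [|n IH] x x0 /=; first by rewrite leNgt x0.
have y0 : x / beta < 0 by rewrite ltr_pdivrMr ?mul0r.
by rewrite /operator !IH ?mulr0 ?addr0//; lra.
Qed.

Let approx_ge1 n x : 1 <= x -> approx n x = 1.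
Proof.
have bV := ge2_invr _ _ hbeta.
elim: n x => [|n IH] x x1 /=; first by rewrite (le_trans ler01).
have y1 : beta^-1 <= x / beta by rewrite ler_peMl// invr_ge0 ltW.
by rewrite /operator !IH; lra.
Qed.

(* An infimum of nondecreasing right-continuous functions is right-continuous,
   which is why the iteration starts from above. *)
Let approx_rc n x e :
  0 < e -> exists2 d, 0 < d & approx n (x + d) < approx n x + e.
Proof.
case/andP: (hp) => p0 p1; elim: n x => [|n IH] x e0 /=.
  have [x0|x0] := leP 0 x.
    by exists 1 => //; rewrite addr_ge0//= ltrDl.
  by exists (- x / 2); [lra|rewrite leNgt (_ : x + _ < 0) ?add0r//; lra].
have [d1 d1_gt0 H1] := IH (x / beta) e0.
have [d2 d2_gt0 H2] := IH (x / beta + 1 - beta^-1) e0.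
pose d := Num.min d1 d2.
have dd1 : d <= d1 by rewrite ge_min lexx.
have dd2 : d <= d2 by rewrite ge_min lexx orbT.
exists (beta * d); first by rewrite mulr_gt0// lt_min d1_gt0.
rewrite /operator.
have -> : (x + beta * d) / beta = x / beta + d by field; rewrite gt_eqF.
have /approx_nd K1 : x / beta + d <= x / beta + d1 by rewrite lerD2l.
have /approx_nd K2 : x / beta + d + 1 - beta^-1 <= x / beta + 1 - beta^-1 + d2.
  by lra.
have {K1}H1 := le_lt_trans (K1 n) H1; have {K2}H2 := le_lt_trans (K2 n) H2.
move: H1 H2; rewrite -/(approx n).
move: (approx n _) (approx n _) (approx n _) (approx n _) => a b c d'.
nra.
Qed.

Let limit x := limn (approx ^~ x).

Let approx_bounds n x : 0 <= approx n x <= 1.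
Proof.
apply/andP; split.
  have [x0|x0] := ltP x 0; first by rewrite approx_lt0.
  by rewrite -(@approx_lt0 n (-1)) ?approx_nd//; lra.
have [x1|x1] := leP 1 x; first by rewrite approx_ge1.
by rewrite -(@approx_ge1 n 1) ?approx_nd// ltW.
Qed.

Let approx_cvg x : approx ^~ x @ \oo --> limit x.
Proof.
apply: nonincreasing_is_cvgn => //; exists 0 => _ [n _ <-].
by case/andP: (approx_bounds n x).
Qed.

Let limit_nd : {homo limit : x y / x <= y}.
Proof.
move=> x y xy; apply: ler_lim; [exact: approx_cvg|exact: approx_cvg|].
by apply: nearW => n; exact: approx_nd.
Qed.

(** For x <= y <= x + d, limit y <= limit (x + d) <= approx n (x + d) < approx n x + e/2 < limit x +
    e. *)
Let limit_rc : right_continuous limit.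
Proof.
move=> x; apply/cvgrPdist_lt => e e0.
have e20 : 0 < e / 2 by lra.
have [n Hn] : exists n, approx n x < limit x + e / 2.
  have : limit x < limit x + e / 2 by rewrite ltrDl.
  by move=> /(cvgr_lt _ (approx_cvg x)) [n _ H]; exists n; apply: H => /=.
have [d d0 Hd] := approx_rc n x _ e20.
near=> y.
have xy : x <= y by near: y; exact: nbhs_right_ge.
rewrite distrC ger0_norm ?subr_ge0 ?limit_nd//.
have /limit_nd K1 : y <= x + d.
  by near: y; apply: nbhs_right_le; rewrite ltrDl.
have := nonincreasing_cvgn_ge (approx_dec (x + d)) (approx_cvg (x + d)) n.
rewrite -/(limit _); lra.
Unshelve. all: by end_near. Qed.

Let limit_Ny : limit @ -oo --> (0 : R).
Proof.
apply: cvg_near_cst.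
exists 0; split => // x x0; rewrite /limit (_ : approx ^~ x = cst 0) ?lim_cst//.
by apply/funext => n; exact: approx_lt0.
Qed.

Let limit_y : limit @ +oo --> (1 : R).
Proof.
apply: cvg_near_cst.
exists 1; split => // x x1; rewrite /limit (_ : approx ^~ x = cst 1) ?lim_cst//.
by apply/funext => n; apply: approx_ge1; rewrite ltW.
Qed.

HB.instance Definition _ := isCumulative.Build R _ R limit limit_nd limit_rc.
HB.instance Definition _ :=
  isCumulativeBounded.Build R 0 1 limit limit_Ny limit_y.

Let limit_selfsimilar : selfsimilar_eq beta p limit.
Proof.
move=> x; apply: (cvg_unique _ (approx_cvg x)) => //=.
(* The shifted sequence is the operator applied to [approx n], so it also converges to the
   right-hand side at [limit]. *)
rewrite -(cvg_shiftn 1); under eq_fun do rewrite addn1.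
by apply: cvgD; apply: cvgMl_tmp; exact: approx_cvg.
Qed.

Lemma selfsimilar_distribution_exists :
  exists F, is_distribution_function F /\ selfsimilar_eq beta p F.
Proof. by exists limit; split; [exists limit|]. Qed.

End existence.

(** * The functions selected by the definite descriptions *)

Section Fdist_nu.
Context {R : realType} (beta p : R).
Hypotheses (hbeta : 0 < beta <= 1 / 2) (hp : 0 < p < 1).

Lemma Fdist_unit_solution : unit_solution beta p (Fdist beta p).
Proof.
have [distF FE] := getPex (selfsimilar_distribution_exists _ _ hbeta hp).
exact: distribution_unit_solution.
Qed.

Let beta_gt0 : 0 < beta. Proof. by case/andP: hbeta. Qed.
Let p_gt0 : 0 < p. Proof. by case/andP: hp. Qed.
Let lnbeta_lt0 : ln beta < 0.
Proof. by rewrite ln_lt0// beta_gt0; case/andP: hbeta => _; lra. Qed.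
Let period : R := `|ln beta|.
Let periodE : period = - ln beta. Proof. exact: ltr0_norm. Qed.

(** The factor p^-n produced here cancels the p^n of [unit_solution_scale]; this makes the formula
    for [nu] periodic. *)
Let expR_scale (n : nat) t :
  expR (- (t - period *+ n) * (ln p / ln beta)) =
  expR (- t * (ln p / ln beta)) / p ^+ n.
Proof.
have -> : - (t - period *+ n) * (ln p / ln beta) =
    - t * (ln p / ln beta) - n%:R * ln p.
  by rewrite periodE -mulr_natl; field; rewrite lt_eqF.
by rewrite expRD expRN expRM_natl lnK.
Qed.

Let expR_shift (n : nat) t : expR (t - period *+ n) = beta ^+ n * expR t.
Proof.
by rewrite periodE mulNrn opprK -mulr_natl expRD expRM_natl lnK// mulrC.
Qed.

Lemma nu_spec : periodic (nu beta p) `|ln beta| /\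
  forall t : R, t <= 0 ->
    nu beta p t = expR (- t * (ln p / ln beta)) * Fdist beta p (expR t).
Proof.
pose g (t : R) := expR (- t * (ln p / ln beta)) * Fdist beta p (expR t).
have g_shift n t : t <= 0 -> g (t - period *+ n) = g t.
  move=> t0; rewrite /g expR_scale expR_shift.
  rewrite (unit_solution_scale _ _ hbeta _ _ _ Fdist_unit_solution) ?expR_le1//.
  by field; rewrite expf_neq0// gt_eqF.
have g_coh t m n : t - period *+ m <= 0 -> t - period *+ n <= 0 ->
    g (t - period *+ m) = g (t - period *+ n).
  wlog mn : m n / (m <= n)%N => [H|] tm tn.
    by case/orP: (leq_total m n) => mn; [|apply/esym]; exact: H.
  by rewrite -[in RHS](subnKC mn) mulrnDr opprD addrA (g_shift (n - m)%N).
(* The extension of [g] to all t moves t down to the nonpositive half-line by enough periods; by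
   [g_coh] the number of periods does not affect the value. *)
pose N (t : R) := (Num.truncn (`|t| / period)).+1.
have N_le0 t : t - period *+ N t <= 0.
  rewrite subr_le0 (le_trans (ler_norm t))// -mulr_natl -ler_pdivrMr ?ltW
    ?truncnS_gt//.
  by rewrite normr_gt0 lt_eqF.
have ex : exists f : R -> R,
    periodic f period /\ forall t : R, t <= 0 -> f t = g t;
  last exact: getPex ex.
exists (fun t => g (t - period *+ N t)); split=> [t|t t0].
  (* Adding one period to t uses up one of the N periods subtracted; N is a successor, so its
     predecessor is exact. *)
  have E : t + period - period *+ N (t + period) =
           t - period *+ (N (t + period)).-1 by rewrite /= mulrS; ring.
  by rewrite E; apply: g_coh; rewrite -?E.
exact: g_shift.
Qed.

(** The formula of [nu_spec] covers only ln y <= 0; for larger y, periodicity replaces ln y by the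
    logarithm of beta^N y. *)
Lemma powR_nuE (N : nat) (y : R) : 0 < y -> beta ^+ N * y <= 1 ->
  y `^ (ln p / ln beta) * nu beta p (ln y) =
  Fdist beta p (beta ^+ N * y) / p ^+ N.
Proof.
move=> y0 Ny1; have [nuP nuE] := nu_spec.
rewrite -(subrK (period *+ N) (ln y)) (periodicn nuP).
have E : expR (ln y - period *+ N) = beta ^+ N * y by rewrite expR_shift lnK.
rewrite nuE; last by rewrite -expR_le1 E.
rewrite expR_scale E /powR gt_eqF// mulNr expRN.
by rewrite [ln y * _]mulrC !mulrA mulfV ?gt_eqF ?expR_gt0// mul1r mulrC.
Qed.

End Fdist_nu.

(** * Reflection formula and the limit theorem *)

Lemma Fdist_reflect (R : realType) (beta p x : R) :
  0 < beta <= 1 / 2 -> 0 < p < 1 ->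
  Fdist beta p (1 - x) = 1 - Fdist beta (1 - p) x.
Proof.
move=> hb hp; have hq : 0 < 1 - p < 1 by lra.
have solp := unit_solution_reflect _ _ _ _ (Fdist_unit_solution _ _ hb hp).
have solq := Fdist_unit_solution _ _ hb hq.
by rewrite -(unit_solution_unique _ _ hb hq _ _ solp solq) subKr.
Qed.

Theorem proposition2p2 (R : realType) (beta p q : R)
  (hbeta : 0 < beta <= 1 / 2) (hp : 0 < p < 1) (hq : q = 1 - p)
  (hne : (beta, p) <> (1 / 2, 1 / 2)) :
  let a := fun n : nat => 1 / beta ^+ n in
  let b := fun _ : nat => 1 : R in
  let k := fun n : nat => Num.truncn (1 / q ^+ n) in
  forall x : R, x < 0 ->
    (fun n : nat => Fdist beta p (x / a n + b n) ^+ k n) @ \oo -->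
      expR (- ((- x) `^ (ln q / ln beta) * nu beta q (ln (- x)))).
Proof.
move=> a b k x x0; have hq1 : 0 < q < 1 by lra.
have /andP[q0 _] := hq1; have /andP[beta0 beta_le] := hbeta.
have solq := Fdist_unit_solution _ _ hbeta hq1.
have y0 : 0 < - x by rewrite oppr_gt0.
have [||N /ltW Ny] := @exprn_mul_small _ beta (- x) 1; [lra|exact: ltr01|].
have LE := powR_nuE _ _ hbeta hq1 _ _ y0 Ny.
set L := _ * nu _ _ _ in LE *.
have L0 : 0 <= L.
  rewrite LE divr_ge0// ?exprn_ge0 ?(ltW q0)//.
  by case: solq => _ _ /(_ (beta ^+ N * - x)) /andP[].
apply: cvg_trans (power_exp_cvg _ _ _ hq1 L0); apply: near_eq_cvg.
near=> n; have Nn : (N <= n)%N by near: n; exact: nbhs_infty_ge.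
have -> : x / a n + b n = 1 - beta ^+ n * - x.
  by rewrite /a /b div1r invrK; ring.
rewrite Fdist_reflect// -hq LE.
(* For n >= N, scaling from beta^N (-x) <= 1 by the remaining n - N steps turns the value into q^n
   L. *)
suff -> : Fdist beta q (beta ^+ n * - x) =
    q ^+ n * (Fdist beta q (beta ^+ N * - x) / q ^+ N) by [].
rewrite -(subnK Nn) !exprD -mulrA (unit_solution_scale _ _ hbeta _ _ _ solq)//.
by rewrite -mulrA [q ^+ N * _]mulrC divfK// expf_neq0// gt_eqF.
Unshelve. all: by end_near. Qed.
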